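(* Let $X$ and $Y$ be separable metrizable spaces, $X$ nonempty, let $(W_m)_{m\in\omega}$ be a good basis of $X$, and let $f:X\rightarrow Y$ be a function. Then $f$ is recoverable if and only if $f$ is Baire class one.
   Context: $f:X\to Y$ is Baire class one if $f^{-1}(U)$ is an $F_\sigma$ subset of $X$ for every open $U\subseteq Y$. A basis $(W_m)_{m\in\omega}$ for the topology of $X$ is a good basis if for each open $U\subseteq X$ and each $x\in U$ there is $m_0$ such that for all $m\geq m_0$: if $x\in W_m$ then $W_m\subseteq U$. Let $D=(x_p)_{p\in\omega}$ be a dense sequence in $X$ and $x\in X$. The path to $x$ based on $D$ is the sequence $(s_n[x,D])_{n\in\omega}$ defined by: $s_0[x,D]:=x_0$; $s_{n+1}[x,D]:=s_n[x,D]$ if $x=s_n[x,D]$; otherwise $s_{n+1}[x,D]:=x_p$, where $p$ is the least integer such that there exists $m\in\omega$ with $\{x,x_p\}\subseteq W_m\subseteq X\setminus\{s_0[x,D],\ldots,s_n[x,D]\}$. $f$ is recoverable with respect to $D$ if for each $x\in X$ the sequence $(f(s_n[x,D]))_n$ tends to $f(x)$. $f$ is recoverable if there exists a dense sequence $D$ of $X$ such that $f$ is recoverable with respect to $D$. *)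

(* Defs.v *)
From mathcomp Require Import all_boot all_order all_algebra.
From mathcomp Require Import all_classical all_reals all_analysis.
From mathcomp Require Import borel_hierarchy.

Set Implicit Arguments.
Unset Strict Implicit.
Unset Printing Implicit Defensive.

Import Order.TTheory GRing.Theory Num.Theory.
Local Open Scope classical_set_scope.
Local Open Scope ring_scope.

Definition is_metric (R : realType) (T : Type) (d : T -> T -> R) : Prop :=
  [/\ forall x y, 0 <= d x y,
      forall x y, d x y = 0 <-> x = y,
      forall x y, d x y = d y x &
      forall x y z, d x z <= d x y + d y z].

Definition metrizable (R : realType) (T : topologicalType) : Prop :=
  exists2 d : T -> T -> R, is_metric d &
    forall U : set T, open U <->
      forall x, U x -> exists2 e : R, 0 < e & [set y | d x y < e] `<=` U.

Definition separable (T : topologicalType) : Prop :=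
  exists2 A : set T, countable A & dense A.

Definition Baire_class_one (X Y : topologicalType) (f : X -> Y) : Prop :=
  forall U : set Y, open U -> Fsigma (f @^-1` U).

Definition good_basis (X : topologicalType) (W : nat -> set X) : Prop :=
  basis (range W) /\
  forall (U : set X) (x : X), open U -> U x ->
    exists m0 : nat, forall m : nat, (m0 <= m)%N -> W m x -> W m `<=` U.

(* [0%N] is a junk value, returned only when [P] is empty. *)
Definition least (P : set nat) : nat :=
  xget 0%N [set p | P p /\ forall q, P q -> (p <= q)%N].

(* [path_history W D x n] is the list [s_n; ...; s_0] of the first n+1 points
   of the path, most recent first. When D is dense and W is a basis, the set
   given to [least] is nonempty, since x is not in the history
   as long as s_n <> x. *)
Fixpoint path_history (X : topologicalType) (W : nat -> set X) (D : nat -> X)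
    (x : X) (n : nat) : seq X :=
  if n is n'.+1 then
    let h := path_history W D x n' in
    let s := head (D 0%N) h in
    (if x == s then s
     else D (least [set p | exists m : nat,
                 [set x; D p] `<=` W m /\ W m `<=` ~` [set` h]])) :: h
  else [:: D 0%N].

Definition path_to (X : topologicalType) (W : nat -> set X) (D : nat -> X)
    (x : X) (n : nat) : X :=
  head (D 0%N) (path_history W D x n).

Definition recoverable_wrt (X Y : topologicalType) (W : nat -> set X)
    (D : nat -> X) (f : X -> Y) : Prop :=
  forall x : X, (fun n => f (path_to W D x n)) @ \oo --> f x.

Definition recoverable (X Y : topologicalType) (W : nat -> set X)
    (f : X -> Y) : Prop :=
  exists2 D : nat -> X, dense (range D) & recoverable_wrt W D f.

(* Main.v *)
Require Import Defs.
From mathcomp Require Import all_boot all_order all_algebra.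
From mathcomp Require Import all_classical all_reals all_analysis.
From mathcomp Require Import borel_hierarchy.
From mathcomp Require Import lra zify.

(* Let r(m) be the first point of D lying in W_m. The path to x consists of x_0
   and the points r(m) with x in W_m, so f is recoverable with respect to D iff,
   for every x, f(r(m)) tends to f(x) as m tends to infinity among the m with
   x in W_m.

   If this holds and U is open, exhaust U by sets F_k. For x not isolated, f(x)
   is in U iff for some k and N every m >= N with x in W_m satisfies
   f(r(m)) in F_k, and this is an F_sigma condition. Isolated points are
   singletons W_m.

   Conversely, if f is Baire class one there are closed sets C_n such that each
   neighbourhood of f(x) contains f(C_n) for some C_n containing x. Encode the
   membership of y in C_0, ..., C_{n-1} as a binary word, C_0 most significant.
   For m large with x in W_m, the point x has the largest word of length n in
   W_m. It thus suffices to order a dense sequence so that, for each n, all but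
   finitely many points e of the sequence have the following property: in each
   basic set containing e, either e has the largest word of length n or some
   earlier point of the sequence lies in that set. *)

Local Open Scope classical_set_scope.

(** * Least elements and first points of basic sets *)

Lemma least_spec {P : set nat} {p : nat} : P p ->
  P (least P) /\ forall q, P q -> (least P <= q)%N.
Proof.
move=> Pp; apply: (@xgetPex _ 0%N [set p | P p /\ forall q, P q -> (p <= q)%N]).
have ex : exists n, `[< P n >] by exists p; apply/asboolP.
exists (ex_minn ex); case: ex_minnP => n /asboolP Pn nmin; split=> // q Pq.
by apply: nmin; apply/asboolP.
Qed.

Lemma least_in {P : set nat} {p : nat} : P p -> P (least P).
Proof. by move=> /least_spec[]. Qed.

Lemma least_le {P : set nat} {p : nat} : P p -> (least P <= p)%N.
Proof. by move=> Pp; apply: (proj2 (least_spec Pp)). Qed.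

(** The point r(m) of the overview is [D (first_index W D m)]. *)
Definition first_index {X : Type} (W : nat -> set X) (D : nat -> X) (m : nat) :
  nat := least [set p | W m (D p)].

(** * Good bases of T1 spaces *)

Section GoodBasis.
Context {X : topologicalType} {W : nat -> set X}.
Hypothesis X_T1 : accessible_space X.
Hypothesis W_good : good_basis W.

Let finite_closed (A : set X) : finite_set A -> closed A.
Proof. exact: (accessible_finite_set_closed.1 X_T1). Qed.

Lemma good_basis_open m : open (W m).
Proof. by case: W_good => -[Wo _] _; apply: Wo; exists m. Qed.

Lemma good_basis_sub {U : set X} {x : X} : open U -> U x ->
  exists2 m, W m x & W m `<=` U.
Proof.
move=> Uo Ux; case: W_good => -[_ Wb] _.
have [V [[m _ <-] Wmx] WU] := Wb x U (open_nbhs_nbhs (conj Uo Ux)).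
by exists m.
Qed.

(** In a T1 space the complement of [A] minus [x] is an open set around [x], to which goodness
    applies. *)
Lemma good_basis_avoid {A : set X} (x : X) : finite_set A ->
  exists m0, forall m, (m0 <= m)%N -> W m x ->
    forall y, A y -> W m y -> y = x.
Proof.
move=> Afin.
have Ao : open (~` (A `\ x)).
  by apply: closed_openC; apply: finite_closed; exact: finite_setD.
have [m0 m0P] := W_good.2 _ x Ao (fun xA => xA.2 erefl).
exists m0 => m lem Wx y Ay Wy; apply: contrapT => neq.
by apply: (m0P m lem Wx y Wy).
Qed.

(** Otherwise only finitely many [W m] contain [x]. Picking in each a point other than [x] and
    removing these points leaves a neighbourhood of [x] that includes no basic set around [x]. *)
Lemma good_basis_limit {x : X} (N : nat) :
  (forall m, W m <> [set x]) -> exists2 m, (N <= m)%N & W m x.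
Proof.
move=> x_lim; apply: contrapT => noW.
have ex_other m : exists y, W m x -> W m y /\ y <> x.
  have [Wx|nWx] := pselect (W m x); last by exists x.
  apply: contrapT => noy; apply: (x_lim m); rewrite eqEsubset.
  split=> [z Wz|z ->//]; by apply: contrapT => zx; apply: noy; exists z.
have [y yP] := boolp.choice ex_other.
pose A := [set z | exists2 m, (m < N)%N & z = y m /\ W m x].
have [||m Wmx WU] := @good_basis_sub (~` A) x.
- apply: closed_openC; apply: finite_closed.
  apply: (@sub_finite_set _ _ (y @` `I_N)); last exact: finite_image.
  by move=> _ [m mN [-> _]]; exists m.
- by move=> [m _ [xy /yP[_]]]; rewrite -xy.
have mN : (m < N)%N.
  by rewrite ltnNge; apply/negP => Nm; apply: noW; exists m.
by apply: (WU (y m)); [case: (yP m Wmx)|exists m].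
Qed.

(** * The path to a point and the first points of basic sets *)

Section Path.
Context {D : nat -> X}.
Hypothesis D_dense : dense (range D).

Lemma first_index_in (m p : nat) : W m (D p) -> W m (D (first_index W D m)).
Proof. exact: (@least_in [set p | W m (D p)]). Qed.

Lemma first_index_le (m p : nat) : W m (D p) -> (first_index W D m <= p)%N.
Proof. exact: (@least_le [set p | W m (D p)]). Qed.

Lemma meets_range {m : nat} {x : X} : W m x -> W m (D (first_index W D m)).
Proof.
move=> Wx; have Wm0 : W m !=set0 by exists x.
have [z [Wz [p _ pz]]] := D_dense _ Wm0 (good_basis_open m).
by apply: (@first_index_in m p); rewrite pz.
Qed.

Let s := path_to W D.

Definition candidates (x : X) (n : nat) : set nat :=
  [set p | exists m, [set x; D p] `<=` W m /\
                     W m `<=` ~` [set` path_history W D x n]].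

Lemma path_toS_eq x n : x = s x n -> s x n.+1 = x.
Proof. by rewrite /s /path_to /= => <-; rewrite eqxx. Qed.

Lemma path_toS_neq x n : x <> s x n -> s x n.+1 = D (least (candidates x n)).
Proof. by rewrite /s /path_to /=; case: eqP. Qed.

Lemma path_to_stable {x : X} {n k : nat} : x = s x n -> (n <= k)%N -> s x k = x.
Proof.
move=> xs; elim: k => [|k IH]; first by rewrite leqn0 => /eqP <-.
by rewrite leq_eqVlt => /orP[/eqP <-//|/IH sk]; apply: path_toS_eq.
Qed.

Lemma mem_path_history x n y :
  y \in path_history W D x n <-> exists2 i, (i <= n)%N & y = s x i.
Proof.
elim: n => [|n IH].
  rewrite /= inE; split=> [/eqP ->|[i]]; first by exists 0%N.
  by rewrite leqn0 => /eqP -> ->.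
have -> : path_history W D x n.+1 = s x n.+1 :: path_history W D x n by [].
rewrite inE; split=> [/orP[/eqP ->|/IH[i ni ->]]|[i]].
- by exists n.+1.
- by exists i => //; apply: leqW.
rewrite leq_eqVlt => /orP[/eqP -> ->|ni yi]; first by rewrite eqxx.
by apply/orP; right; apply/IH; exists i.
Qed.

Lemma first_index_candidate {x : X} {n m : nat} : W m x ->
  (forall i, (i <= n)%N -> ~ W m (s x i)) -> candidates x n (first_index W D m).
Proof.
move=> Wx Ws; exists m; split=> [y [->//|->]|y Wy].
  exact: meets_range Wx.
by move=> /mem_path_history[i ni yi]; apply: (Ws i ni); rewrite -yi.
Qed.

(* The least candidate is the first point of the basic set witnessing it,
   because every point of [D] in that set is a candidate. *)
Lemma path_toS_first_index {x : X} {n : nat} : x <> s x n ->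
  exists m, [/\ W m x, s x n.+1 = D (first_index W D m) &
                forall i, (i <= n)%N -> ~ W m (s x i)].
Proof.
move=> xs.
have fin : finite_set [set` path_history W D x n] by exact: finite_seq.
have [||m0 Wx0 Wh0] := @good_basis_sub (~` [set` path_history W D x n]) x.
- by apply: closed_openC; apply: finite_closed.
- move=> /mem_path_history[i ni xi]; apply: xs; apply/esym.
  exact: path_to_stable xi ni.
have cand0 : candidates x n (first_index W D m0).
  apply: first_index_candidate => // i ni /Wh0; apply.
  by apply/mem_path_history; exists i.
have [m [xpW Wh]] := least_in cand0.
have Wx : W m x by apply: xpW; left.
have Wp : W m (D (least (candidates x n))) by apply: xpW; right.
have avoid i : (i <= n)%N -> ~ W m (s x i).
  by move=> ni /Wh; apply; apply/mem_path_history; exists i.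
exists m; split=> //; rewrite path_toS_neq//; congr D; apply/eqP.
rewrite eqn_leq first_index_le// andbT.
exact/least_le/first_index_candidate.
Qed.

(* While the path stays out of [W m], the index [first_index W D m] remains
   a candidate, so the strictly increasing indices of the path are bounded by
   it; when the path first enters [W m] it does so at that index. *)
Lemma path_to_visits {x : X} {m : nat} : W m x ->
  exists n, s x n = D (first_index W D m).
Proof.
move=> Wx.
have step n : (forall i, (i <= n)%N -> ~ W m (s x i)) ->
    [/\ candidates x n (least (candidates x n)),
        (least (candidates x n) <= first_index W D m)%N &
        s x n.+1 = D (least (candidates x n))].
  move=> Ws; have c := first_index_candidate Wx Ws.
  split; [exact: least_in c|exact: least_le|apply: path_toS_neq => xs].
  by apply: (Ws n) => //; rewrite -xs.
have [n Wn] : exists n, W m (s x n).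
  apply: contrapT => noW.
  have out n i : (i <= n)%N -> ~ W m (s x i).
    by move=> _ Wi; apply: noW; exists i.
  have incr n : (n <= least (candidates x n))%N.
    elim: n => // n IH; apply: (leq_ltn_trans IH).
    have [[k [xk kh]] _ sS] := step n.+1 (out _).
    have [_ _ sn] := step n (out _).
    rewrite ltn_neqAle; apply/andP; split; last first.
      apply: least_le; exists k; split=> // y /kh yh yn; apply: yh.
      apply/mem_path_history; case/mem_path_history: yn => i ni ->.
      by exists i => //; exact: leqW.
    apply/eqP => eqp; apply: (kh (D (least (candidates x n)))).
      by rewrite eqp; apply: xk; right.
    by apply/mem_path_history; exists n.+1.
  have [_ ub _] := step (first_index W D m).+1 (out _).
  by have := leq_trans (incr _) ub; rewrite ltnn.
have [Wl lmin] := @least_spec [set n | W m (s x n)] n Wn.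
move: (least _) Wl lmin => [|k] /= Wk kmin.
  exists 0%N; have := @first_index_le m 0 Wk; rewrite leqn0 => /eqP ->.
  by [].
have [|c le sk] := step k; first by move=> i ik /kmin; rewrite ltnNge ik.
exists k.+1; rewrite sk; congr D; apply/eqP; rewrite eqn_leq le.
by apply: first_index_le; rewrite -sk.
Qed.

End Path.

(** The points after [x_0] on a path that never reaches [x] are first points of basic sets around
    [x], and conversely the path visits all such first points. It remains to compare the two ways of
    going to infinity. *)
Lemma recoverable_wrtE {Y : topologicalType} {D : nat -> X} {f : X -> Y} :
  dense (range D) ->
  recoverable_wrt W D f <->
  forall (x : X) (V : set Y), nbhs (f x) V ->
    exists m0, forall m, (m0 <= m)%N -> W m x -> V (f (D (first_index W D m))).
Proof.
move=> D_dense; split=> [fD x V Vfx|fD x V Vfx].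
  have [N _ NP] := fD x V Vfx.
  have fin := finite_image (path_to W D x) (finite_II N).
  (* For large [m], the first point of [W m] is either [x] or visited only at times at least [N]. *)
  have [m0 m0P] := good_basis_avoid x fin.
  exists m0 => m mm0 Wx; have [n sn] := path_to_visits D_dense Wx.
  have [Nn|nN] := leqP N n; first by rewrite -sn; apply: NP.
  rewrite (m0P m mm0 Wx (D (first_index W D m))); first exact: nbhs_singleton.
    by exists n.
  exact: meets_range Wx.
have [[n xn]|neq] := pselect (exists n, x = path_to W D x n).
  exists n => // k nk /=; rewrite (path_to_stable xn nk).
  exact: nbhs_singleton.
have {}neq n : x <> path_to W D x n by move=> xn; apply: neq; exists n.
have [m mP] := choice (fun n => @path_toS_first_index D D_dense x n (neq n)).
(* The set [W (m j)] avoids the points visited up to time [j], whereas [W (m i)] contains the point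
   visited at time [i.+1]. Injectivity then makes [m n] tend to infinity. *)
have m_inj : injective m.
  suff lt_neq i j : (i < j)%N -> m i <> m j.
    by move=> i j mij; case: (ltngtP i j) => // /lt_neq; rewrite mij.
  move=> ij mij; have [_ _ /(_ i.+1 ij)] := mP j; have [Wx -> _] := mP i.
  by rewrite -mij; apply; exact: meets_range Wx.
have [m0 m0P] := fD x V Vfx.
have [N NP] : exists N, forall n, (N <= n)%N -> (m0 <= m n)%N.
  elim: m0 {m0P} => [|k [N NP]]; first by exists 0%N.
  have [[n0 mn0]|nok] := pselect (exists n0, m n0 = k).
    exists (maxn N n0.+1) => n; rewrite geq_max => /andP[/NP kn n0n].
    rewrite ltn_neqAle kn andbT; apply/eqP => kmn.
    by move: n0n; rewrite (m_inj n0 n) ?ltnn// mn0.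
  exists N => n /NP kn; rewrite ltn_neqAle kn andbT; apply/eqP => kmn.
  by apply: nok; exists n.
exists N.+1 => //= -[//|n] Nn /=.
have [Wx -> _] := mP n; exact/m0P/Wx/NP.
Qed.

End GoodBasis.

(** * Countable bases and exhaustions in metrizable spaces *)

Section Metrizable.
Context {R : realType} {T : topologicalType}.
Hypothesis T_metrizable : metrizable R T.
Import GRing.Theory Num.Theory Order.TTheory.
Local Open Scope ring_scope.

Lemma metrizable_accessible : accessible_space T.
Proof.
case: T_metrizable => d [d_ge0 d_eq0 _ _] d_open x y xy.
exists (~` [set y]); split; [|by apply/mem_set/eqP|by apply/mem_set; apply].
apply/d_open => z zy; exists (d z y).
  by rewrite lt_neqAle d_ge0 andbT eq_sym; apply/eqP => /d_eq0.
by move=> t /= dt ty; move: dt; rewrite ty ltxx.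
Qed.

Lemma metrizable_basis : separable T ->
  exists B : nat -> set T, (forall k, open (B k)) /\
    forall (V : set T) y, open V -> V y -> exists2 k, B k y & B k `<=` V.
Proof.
case=> A /countable_injP[i i_inj] A_dense.
case: T_metrizable => d [d_ge0 d_eq0 dC dD] d_open.
have ball_open x e : open [set y | d x y < e].
  apply/d_open => y /= dy; exists (e - d x y); first by rewrite subr_gt0.
  by move=> z /= dz; apply: (le_lt_trans (dD x y z)); lra.
(* Since [i] is injective on [A], the union has at most one term: the ball of radius 1/(r+1) around
   the point of code [a], if any. No inverse of [i] is needed, and [A] may be empty. *)
pose B k : set T := if unpickle k is Some (a, r) then
  \bigcup_(z in [set z | A z /\ i z = a]) [set y | d z y < r.+1%:R^-1]
  else set0.
exists B; split.
  move=> k; rewrite /B; case: unpickle => [[a r]|]; last exact: open0.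
  by apply: bigcup_open.
move=> V y /d_open Vo /Vo[e e0 eV].
have e20 : 0 < e / 2 by lra.
have [r] := ltr_add_invr e20; rewrite add0r => re.
have r0 : 0 < r.+1%:R^-1 :> R by rewrite invr_gt0 ltr0n.
have yy : d y y = 0 by apply/d_eq0.
have [z [/= yz Az]] : [set z | d y z < r.+1%:R^-1] `&` A !=set0.
  by apply: A_dense => //; exists y; rewrite /= yy.
exists (pickle (i z, r)); rewrite /B pickleK.
  by exists z => //=; rewrite dC.
move=> t [w [Aw /i_inj wz]] /=; rewrite wz ?inE// => zt; apply: eV => /=.
apply: (le_lt_trans (dD y z t)); rewrite (splitr e) ltrD//;
  exact: lt_trans re.
Qed.

(** [F k] collects the points at distance at least 1/(k+1) from the complement of [U].
    Neighbourhoods appear in both clauses because they will be applied to values that merely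
    converge to [y]. *)
Lemma metrizable_exhaustion {U : set T} : open U ->
  exists F : nat -> set T,
    (forall y, U y -> exists k, nbhs y (F k)) /\
    (forall y k, ~ U y -> nbhs y (~` F k)).
Proof.
case: T_metrizable => d [d_ge0 d_eq0 dC dD] d_open /d_open Uo.
have ball_nbhs x e : 0 < e -> nbhs x [set y | d x y < e].
  move=> e0; apply: open_nbhs_nbhs; split; last first.
    by rewrite /= (_ : d x x = 0) //; apply/d_eq0.
  apply/d_open => y /= dy; exists (e - d x y); first by rewrite subr_gt0.
  by move=> z /= dz; apply: (le_lt_trans (dD x y z)); lra.
exists (fun k => [set y | forall z, ~ U z -> k.+1%:R^-1 <= d y z]); split=> y.
  move=> /Uo[e e0 eU]; have e20 : 0 < e / 2 by lra.
  have [k] := ltr_add_invr e20; rewrite add0r => ke; exists k.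
  apply: filterS (ball_nbhs y _ e20) => t /= yt z nUz.
  rewrite leNgt; apply/negP => tz; apply: nUz; apply: eU => /=.
  apply: (le_lt_trans (dD y t z)); rewrite (splitr e) ltrD//.
  exact: lt_trans ke.
move=> k nUy; have r0 : 0 < k.+1%:R^-1 :> R by rewrite invr_gt0 ltr0n.
apply: filterS (ball_nbhs y _ r0) => t /= yt /(_ y nUy).
by rewrite dC leNgt yt.
Qed.

End Metrizable.

(** * From recoverable to Baire class one *)

Lemma recoverable_Baire_class_one {R : realType} {X Y : topologicalType}
    {W : nat -> set X} {f : X -> Y} :
  accessible_space X -> metrizable R Y -> good_basis W ->
  recoverable W f -> Baire_class_one f.
Proof.
move=> X_T1 Y_metrizable W_good [D D_dense].
move=> /(recoverable_wrtE X_T1 W_good D_dense) fD U Uo.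
have [F [F_nbhs F_avoid]] := metrizable_exhaustion Y_metrizable Uo.
(* A point of [G k N] lies in no singleton [W m], and every [W m] around it with [N <= m] has its
   first point sent into [F k]. Isolated points are left to the sets [S m], each with at most one
   point. *)
pose G k N : set X := ~` \bigcup_(m in [set m | (exists x, W m = [set x]) \/
  ((N <= m)%N /\ ~ F k (f (D (first_index W D m))))]) W m.
pose S m : set X := [set x | W m = [set x] /\ U (f x)].
exists (fun n => match unpickle n : option (nat * nat + nat) with
  | Some (inl (k, N)) => G k N | Some (inr m) => S m | None => set0 end).
  move=> n; case: unpickle => [[[k N]|m]|]; last exact: closed0.
    apply: open_closedC; apply: bigcup_open => m _.
    exact: (good_basis_open W_good).
  apply: (accessible_finite_set_closed.1 X_T1).
  have [[x Wx]|noW] := pselect (exists x, W m = [set x]).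
    apply: sub_finite_set (finite_set1 x) => y [].
    by rewrite Wx => /seteqP[/(_ x erefl)].
  by apply: sub_finite_set (finite_set0 _) => y [Wy _]; apply: noW; exists y.
rewrite eqEsubset; split=> [x Ufx|x [n _]].
  have [[m Wm]|x_lim] := pselect (exists m, W m = [set x]).
    by exists (pickle (inr m : nat * nat + nat)%type) => //; rewrite pickleK.
  have [k Fk] := F_nbhs _ Ufx; have [N NP] := fD x _ Fk.
  exists (pickle (inl (k, N) : nat * nat + nat)%type) => //; rewrite pickleK.
  move=> [m [[y Wmy]|[Nm nF]] Wmx]; last by apply: nF; exact: NP.
  by apply: x_lim; exists m; move: Wmx; rewrite Wmy => ->.
case: unpickle => [[[k N] Gx|m [_]]|] //; apply: contrapT => nUfx.
have x_lim m : W m <> [set x].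
  by move=> Wm; apply: Gx; exists m; [left; exists x|rewrite Wm].
(* If [f x] is outside [U], the values at first points eventually leave [F k]; as [x] is not
   isolated, this happens for some [m >= N] with [x] in [W m]. *)
have [m0 m0P] := fD x _ (F_avoid _ k nUfx).
have [m mN Wx] := good_basis_limit X_T1 W_good (maxn N m0) x_lim.
move: mN; rewrite geq_max => /andP[Nm m0m].
by apply: Gx; exists m => //; right; split=> //; apply: m0P.
Qed.

(** * Concatenation of finite lists into a sequence *)

(** [t n] is the position where the block [L n] starts; as no block is empty, the concatenation is
    infinite. *)
Lemma enumerate_blocks {T : Type} (x0 : T) (L : nat -> seq T) :
  (forall n, 0 < size (L n))%N ->
  exists (D : nat -> T) (t : nat -> nat),
    (forall n i, (i < size (L n))%N -> D (t n + i)%N = nth x0 (L n) i) /\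
    (forall N p, (t N <= p)%N ->
       exists n i, [/\ (N <= n)%N, (i < size (L n))%N & p = (t n + i)%N]).
Proof.
move=> L_gt0.
pose P k := flatten [seq L i | i <- iota 0 k].
have PD a b : exists Q, P (a + b)%N = P a ++ Q.
  by eexists; rewrite /P iotaD map_cat flatten_cat.
have PS k : P k.+1 = P k ++ L k.
  by rewrite /P -addn1 iotaD map_cat flatten_cat /= cats0.
pose t k := size (P k).
have tS k : t k.+1 = (t k + size (L k))%N by rewrite /t PS size_cat.
have t_ge k : (k <= t k)%N.
  by elim: k => // k IH; rewrite tS; have := L_gt0 k; lia.
have t_mono a b : (a <= b)%N -> (t a <= t b)%N.
  move=> /subnKC <-; have [Q] := PD a (b - a)%N; rewrite /t => ->.
  by rewrite size_cat leq_addr.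
(* The first p+1 blocks have at least p+1 entries in total, so the default [x0] is never read. *)
exists (fun p => nth x0 (P p.+1) p), t; split=> [n i iL|N p Np].
  have le : (n.+1 <= (t n + i).+1)%N by have := t_ge n; lia.
  have [Q] := PD n.+1 ((t n + i).+1 - n.+1)%N; rewrite subnKC// => ->.
  rewrite nth_cat -/(t _) tS ltn_add2l iL PS nth_cat -/(t _).
  by rewrite ltnNge leq_addr /= addKn.
have ex : exists k, (p < t k)%N by exists p.+1; apply: t_ge.
case: (ex_minnP ex) => -[|n] pt tmin.
  by have := leq_trans pt (t_mono 0 N isT); lia.
have np : (t n <= p)%N by rewrite leqNgt; apply/negP => /tmin; rewrite ltnn.
exists n, (p - t n)%N; split; last by rewrite subnKC.
  by rewrite leqNgt; apply/negP => /t_mono; lia.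
by rewrite tS in pt; lia.
Qed.

(** * Membership words and admissible lists *)

Section Words.
Context {X : topologicalType} {C : nat -> set X}.

Fixpoint word (n : nat) (y : X) : nat :=
  if n is k.+1 then ((word k y).*2 + `[< C k y >])%N else 0%N.

Definition word_max (n : nat) (V : set X) (e : X) : Prop :=
  forall y, V y -> (word n y <= word n e)%N.

Lemma word_lt n y : (word n y < 2 ^ n)%N.
Proof. by elim: n => // n IH; rewrite expnS /=; case: asbool => /=; lia. Qed.

Lemma word_inj {n y z} : word n y = word n z ->
  forall i, (i < n)%N -> C i y -> C i z.
Proof.
elim: n => // n IH /= yz i.
have [yzn Cyz] : word n y = word n z /\ `[< C n y >] = `[< C n z >].
  by move: yz; do 2 case: asbool => /=; lia.
rewrite ltnS leq_eqVlt => /orP[/eqP ->|]; last exact: IH.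
by move/asboolP; rewrite Cyz => /asboolP.
Qed.

(** Dropping the last bit is halving, which is monotone. *)
Lemma word_max_le {n n' V e} : (n <= n')%N -> word_max n' V e -> word_max n V e.
Proof.
move=> /subnK <-; elim: (n' - n)%N => // k IH Vmax; apply: IH => y /Vmax /=.
by do 2 case: asbool => /=; lia.
Qed.

Context {W : nat -> set X}.
Hypothesis C_closed : forall i, closed (C i).
Hypothesis W_good : good_basis W.

(** By induction on [n]: either [x] is in [C n] and its new bit is the largest possible, or every
    late [W m] around [x] misses the closed set [C n], so that the new bit is 0 throughout [W m]. *)
Lemma good_basis_word_max n x :
  exists m0, forall m, (m0 <= m)%N -> W m x -> word_max n (W m) x.
Proof.
elim: n => [|n [m0 m0P]]; first by exists 0%N.
have [Cx|nCx] := pselect (C n x).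
  exists m0 => m lem Wx y /(m0P m lem Wx) /=.
  by rewrite (asboolT Cx); case: asbool => /=; lia.
have [m1 m1P] := W_good.2 _ x (closed_openC (C_closed n)) nCx.
exists (maxn m0 m1) => m; rewrite geq_max => /andP[lem0 lem1] Wx y Wy /=.
have := m0P m lem0 Wx y Wy.
by rewrite (asboolF (m1P m lem1 Wx y Wy)); case: asbool => /=; lia.
Qed.

(** The second alternative says that [e] is not the first listed point of [W j]. The condition
    persists when [P] grows, so admissible lists can be concatenated. *)
Definition may_follow (n : nat) (P : seq X) (e : X) : Prop :=
  forall j, W j e -> word_max n (W j) e \/ exists2 y, y \in P & W j y.

Definition admissible (n : nat) (L : seq X) : Prop :=
  forall x0 i, (i < size L)%N -> may_follow n (take i L) (nth x0 L i).

Lemma admissible_cat n L L' :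
  admissible n L -> admissible n L' -> admissible n (L ++ L').
Proof.
move=> adL adL' x0 i; rewrite size_cat nth_cat take_cat => iL.
case: ltnP => [/adL//|Li].
have iL' : (i - size L < size L')%N by lia.
move=> j /(adL' x0 _ iL' j)[|[y yt Wy]]; [by left|right].
by exists y => //; rewrite mem_cat yt orbT.
Qed.

Lemma admissible_rcons n L e :
  admissible n L -> may_follow n L e -> admissible n (rcons L e).
Proof.
move=> adL Le x0 i; rewrite size_rcons ltnS leq_eqVlt => /orP[/eqP ->|iL].
  by rewrite nth_rcons ltnn eqxx -cats1 take_size_cat.
by rewrite nth_rcons iL -cats1 takel_cat ?(ltnW iL)//; apply: adL.
Qed.

(* Only finitely many [W j] contain [e] without [e] maximizing the word on
   them; points of larger word in these are listed before [e], recursively. *)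
Lemma admissible_exists n e : exists L, admissible n (rcons L e).
Proof.
(* The measure [2 ^ n - word n e] is positive by [word_lt], so it strictly drops when the word
   grows. *)
have [k] := ubnP (2 ^ n - word n e)%N; elim: k e => // k IH e ek.
have [m0 m0P] := good_basis_word_max n e.
suff [L [adL LP]] : exists L, admissible n L /\ forall j, (j < m0)%N -> W j e ->
    word_max n (W j) e \/ exists2 y, y \in L & W j y.
  exists L; apply: admissible_rcons => // j Wj.
  by have [/LP/(_ Wj)//|m0j] := ltnP j m0; left; apply: m0P.
elim: m0 {m0P} => [|m [L [adL LP]]]; first by exists [::]; split.
have [Wmax|nWmax] := pselect (word_max n (W m) e).
  exists L; split=> // j.
  by rewrite ltnS leq_eqVlt => /orP[/eqP ->|/LP//]; left.
have [y Wy ey] : exists2 y, W m y & (word n e < word n y)%N.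
  apply: contrapT => noy; apply: nWmax => y Wy; rewrite leqNgt.
  by apply/negP => ey; apply: noy; exists y.
have [|L' adL'] := IH y; first by have := word_lt n y; lia.
exists (L ++ rcons L' y); split; first exact: admissible_cat.
move=> j; rewrite ltnS leq_eqVlt => /orP[/eqP -> _|jm Wj].
  by right; exists y => //; rewrite mem_cat mem_rcons inE eqxx orbT.
have [|[z zL Wz]] := LP j jm Wj; [by left|right].
by exists z => //; rewrite mem_cat zL.
Qed.

End Words.

(** * From Baire class one to recoverable *)

Lemma Baire_class_one_recoverable {R : realType} {X Y : topologicalType}
    {W : nat -> set X} {f : X -> Y} :
  [set: X] !=set0 -> accessible_space X -> good_basis W ->
  separable Y -> metrizable R Y -> Baire_class_one f -> recoverable W f.
Proof.
move=> [x0 _] X_T1 W_good Y_separable Y_metrizable f_Baire.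
have [B [B_open B_basis]] := metrizable_basis Y_metrizable Y_separable.
have [K KP] : exists K : nat -> nat -> set X, forall b,
    (forall i, closed (K b i)) /\ f @^-1` B b = \bigcup_i K b i.
  have ex b : exists K : nat -> set X,
      (forall i, closed (K i)) /\ f @^-1` B b = \bigcup_i K i.
    by have [K Kc Kf] := f_Baire _ (B_open b); exists K.
  by have [K KP] := boolp.choice ex; exists K.
(* A single enumeration of the closed pieces of all the preimages of basic open sets of [Y]. *)
pose C n := if unpickle n is Some (b, i) then K b i else set0.
have C_closed n : closed (C n).
  by rewrite /C; case: unpickle => [[b i]|]; [exact: (KP b).1|exact: closed0].
have C_f x V : nbhs (f x) V -> exists n, C n x /\ C n `<=` f @^-1` V.
  rewrite nbhsE => -[U [Uo Ufx] UV]; have [b Bfx BU] := B_basis _ _ Uo Ufx.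
  have : (f @^-1` B b) x by [].
  rewrite (KP b).2 => -[i _ Kx]; exists (pickle (b, i)); rewrite /C pickleK.
  split=> // y Ky; apply/UV/BU; suff : (f @^-1` B b) y by [].
  by rewrite (KP b).2; exists i.
have [c cP] : exists c : nat -> X, forall n, W n !=set0 -> W n (c n).
  have ex n : exists y, W n !=set0 -> W n y.
    by have [[y Wy]|noW] := pselect (W n !=set0); [exists y|exists x0].
  by have [c cP] := boolp.choice ex; exists c.
(* Block [n] is admissible for words of length [n] and ends with a point of [W n] whenever there is
   one, which gives density. *)
have [L LP] :=
  boolp.choice (fun n => admissible_exists C_closed W_good n (c n)).
have [|D [t [Dt tD]]] := @enumerate_blocks X x0 (fun n => rcons (L n) (c n)).
  by move=> n; rewrite size_rcons.
have D_dense : dense (range D).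
  move=> U [x Ux] Uo; have [m Wx WU] := good_basis_sub W_good Uo Ux.
  have Wc : W m (c m) by apply: cP; exists x.
  exists (c m); split; first exact: WU.
  exists (t m + size (L m))%N => //; rewrite Dt ?size_rcons//.
  by rewrite nth_rcons ltnn eqxx.
exists D => //; apply/(recoverable_wrtE X_T1 W_good D_dense) => x V Vfx.
have [k [Ckx CV]] := C_f x V Vfx.
(* The bit of [C k] first occurs in words of length k+1, so the points before block k+1 are set
   aside: late [W m] around [x] contain none of them except possibly [x]. *)
have fin := finite_image D (finite_II (t k.+1)).
have [m0 m0P] := good_basis_avoid X_T1 W_good x fin.
have [m1 m1P] := good_basis_word_max C_closed W_good k.+1 x.
exists (maxn m0 m1) => m; rewrite geq_max => /andP[lem0 lem1] Wx.
have Wp : W m (D (first_index W D m)) := meets_range W_good D_dense Wx.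
have p_le q : W m (D q) -> (first_index W D m <= q)%N by exact: first_index_le.
move: (first_index W D m) Wp p_le => p Wp p_le.
have [pt|tp] := ltnP p (t k.+1).
  rewrite (m0P m lem0 Wx (D p) _ Wp); first exact: nbhs_singleton.
  by exists p.
have [n [i [kn iL pE]]] := tD _ _ tp.
have Dp : D p = nth x0 (rcons (L n) (c n)) i by rewrite pE Dt.
(* An earlier point of the block in [W m] would contradict the minimality of [p]; hence [D p] has
   the largest word of length [n] in [W m]. *)
have := LP n x0 i iL m; rewrite -Dp => /(_ Wp)[Wmax|[y yt Wy]]; last first.
  have [q qi yq] : exists2 q, (q < i)%N & y = nth x0 (rcons (L n) (c n)) q.
    have := nth_index x0 yt; move: yt.
    rewrite -index_mem size_takel ?(ltnW iL)// => ltq.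
    by rewrite nth_take// => <-; exists (index y (take i (rcons (L n) (c n)))).
  have /p_le : W m (D (t n + q)%N) by rewrite Dt -?yq// (ltn_trans qi).
  by rewrite pE leq_add2l leqNgt qi.
(* Both [x] and [D p] have the largest word of length k+1 in [W m], so [D p] lies in [C k] along
   with [x]. *)
apply: CV; apply: (word_inj (n := k.+1) _ k _ Ckx) => //.
apply/eqP; rewrite eqn_leq (m1P m lem1 Wx _ Wp) andbT.
exact: (word_max_le kn Wmax).
Qed.

Theorem theorem4 (R : realType) (X Y : topologicalType)
    (X_separable : separable X) (X_metrizable : metrizable R X)
    (Y_separable : separable Y) (Y_metrizable : metrizable R Y)
    (X_nonempty : [set: X] !=set0)
    (W : nat -> set X) (W_good : good_basis W) (f : X -> Y) :
  recoverable W f <-> Baire_class_one f.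
Proof.
have X_T1 := metrizable_accessible X_metrizable.
split; first exact: recoverable_Baire_class_one X_T1 Y_metrizable W_good.
exact: Baire_class_one_recoverable X_nonempty X_T1 W_good Y_separable
  Y_metrizable.
Qed.
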